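(* For every positive integer $p$, there exists a $7p$-colourable $P_5$-free graph $G$ that is not $8p$-mixing, i.e., the reconfiguration graph $\mathcal{R}_{8p}(G)$ is disconnected.
   Context: All graphs are finite and simple. For a positive integer $k$, a $k$-colouring of a graph $G$ is a map $\alpha\colon V(G)\to\{1,\dots,k\}$ with $\alpha(u)\neq\alpha(v)$ for every edge $uv$; $G$ is $k$-colourable if it has a $k$-colouring. The reconfiguration graph $\mathcal{R}_k(G)$ has as vertices the $k$-colourings of $G$, two colourings being adjacent if they differ in colour on exactly one vertex of $G$. $G$ is $k$-mixing if $\mathcal{R}_k(G)$ is connected. $P_5$ denotes the path on $5$ vertices, and $G$ is $P_5$-free if it has no induced subgraph isomorphic to $P_5$. *)

(* Defs.v *)
From mathcomp Require Import all_boot.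

Set Implicit Arguments.
Unset Strict Implicit.
Unset Printing Implicit Defensive.

Record sgraph := SGraph {
  vertex :> finType;
  edge : rel vertex;
  edge_sym : symmetric edge;
  edge_irrefl : irreflexive edge }.

Definition connected (G : sgraph) : Prop := forall x y : G, connect (@edge G) x y.

Definition isomorphic (G H : sgraph) : Prop :=
  exists2 f : G -> H, bijective f & forall x y, edge (f x) (f y) = edge x y.

Section Induced.
Variables (G : sgraph) (S : {set G}).

Definition induced_edge : rel {x : G | x \in S} := fun x y => edge (val x) (val y).

Lemma induced_edge_sym : symmetric induced_edge.
Proof. by move=> x y; apply: edge_sym. Qed.

Lemma induced_edge_irrefl : irreflexive induced_edge.
Proof. by move=> x; apply: edge_irrefl. Qed.

Definition induced : sgraph := SGraph induced_edge_sym induced_edge_irrefl.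
End Induced.

Definition free (H G : sgraph) : Prop :=
  forall S : {set G}, ~ isomorphic (induced S) H.

Section PathGraph.
Variable n : nat.

Definition path_edge : rel 'I_n := fun i j => (i.+1 == j) || (j.+1 == i).

Lemma path_edge_sym : symmetric path_edge.
Proof. by move=> i j; rewrite /path_edge orbC. Qed.

Lemma path_edge_irrefl : irreflexive path_edge.
Proof. by move=> i; rewrite /path_edge orbb -[X in _ == X]addn0 -addn1 eqn_add2l. Qed.

(* The path on n vertices (not n edges). *)
Definition path_graph : sgraph := SGraph path_edge_sym path_edge_irrefl.
End PathGraph.

Section Colouring.
Variables (k : nat) (G : sgraph).

Definition proper_colouring (c : {ffun G -> 'I_k}) : bool :=
  [forall u, forall v, edge u v ==> (c u != c v)].

Definition colouring : finType := {c : {ffun G -> 'I_k} | proper_colouring c}.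

Definition colourable : Prop := exists c : {ffun G -> 'I_k}, proper_colouring c.

Definition reconf_edge : rel colouring :=
  fun a b => #|[set v | val a v != val b v]| == 1.

Lemma reconf_edge_sym : symmetric reconf_edge.
Proof.
move=> a b; rewrite /reconf_edge; congr (_ == 1).
by apply: eq_card => v; rewrite !inE eq_sym.
Qed.

Lemma reconf_edge_irrefl : irreflexive reconf_edge.
Proof.
move=> a; rewrite /reconf_edge (_ : [set _ | _] = set0) ?cards0 //.
by apply/setP => v; rewrite !inE eqxx.
Qed.

Definition reconf_graph : sgraph := SGraph reconf_edge_sym reconf_edge_irrefl.

Definition mixing : Prop := connected reconf_graph.
End Colouring.

(* Main.v *)
Require Import Defs.
From mathcomp Require Import all_boot zify.

(** Take a finite simple graph [H], viewed as a geometry whose points are its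
    vertices and whose lines are its edges, and join two of its flags when
    they differ both in their point and in their line.  An induced [2K2] among
    the flags would give two edges of [H] with the same ends, so there is none,
    and in particular there is no induced [P5].  Colouring a flag by its point
    uses as many colours as [H] has vertices.  Colouring it by its line uses as
    many as [H] has edges, and is frozen: of the two flags on a given edge, at
    least one is adjacent to any given flag on another edge.  Hence [H] need
    only have more edges than vertices; we take [H] to be [K_{2,4p}], with
    [4p + 2 <= 7p] vertices and [8p] edges. *)

Set Implicit Arguments.
Unset Strict Implicit.
Unset Printing Implicit Defensive.

Section Colourings.
Variable G : sgraph.

Lemma proper_colouringP k (c : {ffun G -> 'I_k}) :
  reflect (forall u v, edge u v -> c u != c v) (proper_colouring c).
Proof.
apply: (iffP forallP) => [c_proper u v | c_proper u].
  by have /forallP/(_ v)/implyP := c_proper u.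
by apply/forallP => v; apply/implyP; apply: c_proper.
Qed.

Definition widen_colouring m k (le_mk : m <= k) (c : {ffun G -> 'I_m}) :
  {ffun G -> 'I_k} := [ffun v => widen_ord le_mk (c v)].

Lemma widen_colouring_proper m k (le_mk : m <= k) (c : {ffun G -> 'I_m}) :
  proper_colouring c -> proper_colouring (widen_colouring le_mk c).
Proof.
move=> /proper_colouringP c_proper; apply/proper_colouringP => u v uv.
by rewrite !ffunE -val_eqE; apply: c_proper.
Qed.

Lemma colourable_leq m k : m <= k -> colourable m G -> colourable k G.
Proof.
by move=> le_mk [c /(widen_colouring_proper le_mk)]; exists (widen_colouring le_mk c).
Qed.

Definition rank_colouring (C : finType) (c : G -> C) : {ffun G -> 'I_#|C|} :=
  [ffun v => enum_rank (c v)].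

Lemma rank_colouring_proper (C : finType) (c : G -> C) :
  (forall u v, edge u v -> c u != c v) -> proper_colouring (rank_colouring c).
Proof.
move=> c_proper; apply/proper_colouringP => u v uv.
by rewrite !ffunE (inj_eq enum_rank_inj); apply: c_proper.
Qed.

Definition frozen (C : eqType) (c : G -> C) : Prop :=
  forall (v : G) (i : C), i != c v -> exists2 u, edge v u & c u = i.

Lemma rank_colouring_frozen (C : finType) (c : G -> C) :
  frozen c -> frozen (rank_colouring c).
Proof.
move=> c_frozen v i; rewrite ffunE => i_neq_cv.
have [|u vu cu] := c_frozen v (enum_val i).
  by apply: contraNneq i_neq_cv => <-; rewrite enum_valK.
by exists u; rewrite // ffunE cu enum_valK.
Qed.

Lemma frozen_onto (C : eqType) (c : G -> C) (v : G) (i : C) :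
  frozen c -> exists u, c u = i.
Proof.
move=> c_frozen; have [-> | /c_frozen[u _ <-]] := eqVneq i (c v).
  by exists v.
by exists u.
Qed.

Lemma frozen_isolated k (a b : colouring k G) :
  frozen (val a) -> ~~ reconf_edge a b.
Proof.
move=> a_frozen; apply/negP => /cards1P[v /setP diff_v].
have b_neq_a : val b v != val a v.
  by have := diff_v v; rewrite !inE eqxx eq_sym.
have [u vu au] := a_frozen _ _ b_neq_a.
have u_neq_v : u != v by apply: contraTneq vu => ->; rewrite edge_irrefl.
have b_eq_a : val b u = val a u.
  by have := diff_v u; rewrite !inE (negPf u_neq_v) => /negbFE/eqP.
have /proper_colouringP/(_ v u vu) := valP b.
by rewrite b_eq_a au eqxx.
Qed.

Lemma frozen_not_mixing k (a b : colouring k G) :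
  frozen (val a) -> a != b -> ~ mixing k G.
Proof.
move=> a_frozen a_neq_b mix; have /connectP[[|c s] /= walk b_last] := mix a b.
  by rewrite b_last eqxx in a_neq_b.
by have := frozen_isolated c a_frozen; case/andP: walk => ->.
Qed.

(* A frozen colouring uses every colour, so it differs from one that misses a colour. *)
Lemma colourable_frozen_not_mixing m k (v : G) (a : {ffun G -> 'I_k}) :
  m < k -> colourable m G -> proper_colouring a -> frozen a -> ~ mixing k G.
Proof.
move=> lt_mk [c c_proper] a_proper a_frozen.
pose b := widen_colouring (ltnW lt_mk) c.
pose A : colouring k G := exist _ a a_proper.
pose B : colouring k G := exist _ b (widen_colouring_proper _ c_proper).
apply: (@frozen_not_mixing k A B a_frozen).
apply/eqP => /(congr1 val)/= eq_ab.
have [u] := frozen_onto v (Ordinal lt_mk) a_frozen.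
by rewrite eq_ab ffunE => /(congr1 val)/= cu; have := ltn_ord (c u); rewrite cu ltnn.
Qed.

End Colourings.

Definition two_K2_free (G : sgraph) : Prop :=
  forall x y z t : G, edge x y -> edge z t ->
    [|| edge x z, edge x t, edge y z | edge y t].

Lemma two_K2_free_P5_free (G : sgraph) :
  two_K2_free G -> free (path_graph 5) G.
Proof.
move=> G_free S [f [g _ gK] f_edge].
have g_edge i j : edge (val (g i)) (val (g j)) = path_edge i j.
  by rewrite -[RHS]/(edge (i : path_graph 5) j) -{2}(gK i) -{2}(gK j) f_edge.
have := G_free (val (g (inord 0))) (val (g (inord 1)))
               (val (g (inord 3))) (val (g (inord 4))).
by rewrite !g_edge /path_edge !inordK // => /(_ isT isT).
Qed.

Section FlagGraph.
Variables (P L : finType) (incident : P -> L -> bool).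

Definition flag : finType := {x : P * L | incident x.1 x.2}.
Definition point (x : flag) : P := (val x).1.
Definition line (x : flag) : L := (val x).2.

Definition flag_edge : rel flag :=
  fun x y => (point x != point y) && (line x != line y).

Lemma flag_edge_sym : symmetric flag_edge.
Proof. by move=> x y; rewrite /flag_edge eq_sym (eq_sym (line x)). Qed.

Lemma flag_edge_irrefl : irreflexive flag_edge.
Proof. by move=> x; rewrite /flag_edge eqxx. Qed.

Definition flag_graph : sgraph := SGraph flag_edge_sym flag_edge_irrefl.

Lemma flag_nonedge (x y : flag) :
  ~~ flag_edge x y -> point x = point y \/ line x = line y.
Proof. by rewrite negb_and !negbK => /orP[] /eqP ->; [left | right]. Qed.

Lemma flag_colourable : colourable #|P| flag_graph.
Proof.
exists (rank_colouring (point : flag_graph -> P)).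
by apply: rank_colouring_proper => x y /andP[].
Qed.

Definition partial_linear : Prop := forall p q l m, p != q ->
  incident p l -> incident q l -> incident p m -> incident q m -> l = m.

Definition lines_nondegenerate : Prop :=
  forall l, exists p q, [/\ p != q, incident p l & incident q l].

Hypothesis linear : partial_linear.

Lemma flag_no_rectangle (x y z t : flag) :
  point x = point z -> line z = line y -> point y = point t -> line t = line x ->
  ~~ flag_edge x y.
Proof.
move=> pxz lzy pyt ltx; apply/negP => /andP[pxy /eqP]; apply.
apply: (linear pxy); first exact: (valP x); last exact: (valP y).
  by rewrite pyt -ltx; apply: (valP t).
by rewrite pxz -lzy; apply: (valP z).
Qed.

Lemma flag_two_K2_free : two_K2_free flag_graph.
Proof.
move=> x y z t xy zt; apply: contraLR (xy); rewrite !negb_or.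
case/and4P=> /flag_nonedge xz /flag_nonedge xt /flag_nonedge yz /flag_nonedge yt.
have [/andP[/eqP pxy /eqP lxy] /andP[/eqP pzt /eqP lzt]] := (xy, zt).
case: xz => [pxz | lxz].
  by apply: (@flag_no_rectangle x y z t); case: xt yz yt => ? [] ? [] ?; congruence.
by apply: (@flag_no_rectangle x y t z); case: xt yz yt => ? [] ? [] ?; congruence.
Qed.

Hypothesis nondegenerate : lines_nondegenerate.

Lemma flag_on_line l : exists x, line x = l.
Proof. by have [p [_ [_ pl _]]] := nondegenerate l; exists (exist _ (p, l) pl). Qed.

Lemma line_frozen : frozen (line : flag_graph -> L).
Proof.
move=> x l l_neq; have [p [q [p_neq_q pl ql]]] := nondegenerate l.
have [px | p_neq] := eqVneq (point x) p.
  by exists (exist _ (q, l) ql); rewrite //= /flag_edge px p_neq_q eq_sym.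
by exists (exist _ (p, l) pl); rewrite //= /flag_edge p_neq eq_sym.
Qed.

Lemma flag_not_mixing : #|P| < #|L| -> ~ mixing #|L| flag_graph.
Proof.
move=> lt_PL; have /card_gt0P[l _] : 0 < #|L| by apply: leq_trans lt_PL.
have [x _] := flag_on_line l.
apply: (colourable_frozen_not_mixing (x : flag_graph) lt_PL flag_colourable).
  by apply: rank_colouring_proper => y z /andP[_]; apply.
exact/rank_colouring_frozen/line_frozen.
Qed.

End FlagGraph.

Section CompleteBipartite.
Variables A B : finType.

Definition biclique_incident (p : A + B) (e : A * B) : bool :=
  match p with inl a => a == e.1 | inr b => b == e.2 end.

Lemma biclique_partial_linear : partial_linear biclique_incident.
Proof.
move=> [a|b] [a'|b'] [a1 b1] [a2 b2] /= neq.
- by move=> /eqP eq_a /eqP eq_a'; rewrite eq_a eq_a' eqxx in neq.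
- by move=> /eqP <- /eqP <- /eqP <- /eqP <-.
- by move=> /eqP <- /eqP <- /eqP <- /eqP <-.
- by move=> /eqP eq_b /eqP eq_b'; rewrite eq_b eq_b' eqxx in neq.
Qed.

Lemma biclique_lines_nondegenerate : lines_nondegenerate biclique_incident.
Proof. by move=> [a b]; exists (inl a), (inr b); rewrite /= !eqxx. Qed.

End CompleteBipartite.

Theorem theorem1 (p : nat) (hp : 0 < p) :
  exists G : sgraph,
    [/\ colourable (7 * p) G, free (path_graph 5) G & ~ mixing (8 * p) G].
Proof.
have card_points : #|{: bool + 'I_(4 * p)}| = 2 + 4 * p.
  by rewrite card_sum card_bool card_ord.
have card_lines : #|{: bool * 'I_(4 * p)}| = 8 * p.
  by rewrite card_prod card_bool card_ord mulnA.
exists (flag_graph (@biclique_incident bool 'I_(4 * p))); split.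
- by apply: colourable_leq (flag_colourable _); rewrite card_points; lia.
- exact/two_K2_free_P5_free/flag_two_K2_free/biclique_partial_linear.
- rewrite -card_lines; apply: flag_not_mixing.
    exact: biclique_lines_nondegenerate.
  by rewrite card_points card_lines; lia.
Qed.
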